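(* Let $n\ge 1$ be an integer. The full $2$-by-$n$ rectangle is a P-position in the Remove-a-Square game if and only if $n=12a+1$ for some integer $a\ge 0$.
   Context: Remove-a-Square game: a position is a finite set of unit cells of the square grid (the starting position is a shape made of such cells). Two players alternate moves. In a move, a player chooses a full $k$-by-$k$ square for some $k\ge 1$ (an axis-parallel $k$-by-$k$ block of grid cells, all of which are still present) and removes all its cells. The player without a move loses. A P-position is a position from which the previous player (the one not about to move) wins under perfect play; otherwise it is an N-position. *)

(* Defs.v *)
From mathcomp Require Import all_boot all_order all_algebra.
From mathcomp Require Import finmap.

Set Implicit Arguments.
Unset Strict Implicit.
Unset Printing Implicit Defensive.

Import GRing.Theory.
Local Open Scope fset_scope.

(* A cell of the square grid is named by the integer coordinates of its
   lower-left corner. *)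
Definition cell : Type := (int * int)%type.

Definition position : Type := {fset cell}.

Definition rectangle (c : cell) (m n : nat) : position :=
  [fset (c.1 + i%:Z, c.2 + j%:Z)%R | i in iota 0 m, j in iota 0 n].

Definition move (A B : position) : Prop :=
  exists (k : nat) (c : cell),
    [/\ 1 <= k, rectangle c k k `<=` A & B = A `\` rectangle c k k].

(* The player without a move loses, so a position with no move out of it is a
   P-position.  Every play is finite, since a move removes at least one cell;
   hence the least fixed point below classifies every position. *)
Inductive P_position (A : position) : Prop :=
  | P_intro : (forall B : position, move A B -> N_position B) -> P_position A
with N_position (A : position) : Prop :=
  | N_intro : forall B : position, move A B -> P_position B -> N_position A.

(* Main.v *)
From Stdlib Require Import PeanoNat.
Require Import Defs.
From mathcomp Require Import all_boot all_order all_algebra.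
From mathcomp Require Import finmap.
From mathcomp Require Import zify.

(** The game is a sum of independent impartial games, so Sprague-Grundy theory
    applies.  In a strip of height 2 only single cells and 2-by-2 squares can
    be taken.  Taking one cell of a full column (both cells present) leaves a
    lone cell in it, and no square can use that column any more; taking a
    square empties two adjacent full columns.  Hence a position is a sum of
    its maximal runs of full columns and its lone cells.  A lone cell has
    Grundy value 1, and a run of n full columns has a value g(n) that is the
    least natural number different from every

      g(a) (+) 1 (+) g(b)  with a + 1 + b = n   (one cell of a column taken),
      g(a) (+) g(b)        with a + 2 + b = n   (a square taken),

    where (+) is nim addition.  The sequence g is periodic with period 12 from
    index 72 on ([grundy]).  The recursion is checked by computation up to 168;
    beyond that, one part of every option is long enough to be shortened or
    lengthened by a whole period ([run_option_period]), so that the options of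
    n + 12 and of n have the same values and the check propagates
    ([grundy_mex]).  Among positive n, both the irregular beginning and the
    period have value 0 exactly at n = 1 modulo 12 ([grundy_eq0]).

    The passage to positions goes through the list of the numbers of cells in
    the columns.  The nim-sum of its components ([nim_value]) is changed by
    every move ([column_move_neq]), and from a position with nonzero nim-sum
    some move makes it 0 ([nim_value_reach], which rests on the arithmetic of
    Bouton's theorem, [ltn_nim]).  By induction on the number of cells, the
    P-positions inside the strip are those with nim-sum 0
    ([P_position_nim_value]). *)

Set Implicit Arguments.
Unset Strict Implicit.
Unset Printing Implicit Defensive.

Import GRing.Theory.
Local Open Scope fset_scope.
Local Open Scope nat_scope.

Local Notation "m (+) n" := (Nat.lxor m n) : nat_scope.

(** * Nim addition *)

Lemma nimC m n : m (+) n = n (+) m.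
Proof. exact: Nat.lxor_comm. Qed.

Lemma nimA m n p : m (+) (n (+) p) = m (+) n (+) p.
Proof. by rewrite Nat.lxor_assoc. Qed.

Lemma nimnn n : n (+) n = 0.
Proof. exact: Nat.lxor_nilpotent. Qed.

Lemma nimn0 n : n (+) 0 = n.
Proof. exact: Nat.lxor_0_r. Qed.

Lemma nim0n n : 0 (+) n = n.
Proof. exact: Nat.lxor_0_l. Qed.

Lemma nimK m n : m (+) n (+) n = m.
Proof. by rewrite -nimA nimnn nimn0. Qed.

Lemma nimI p : injective (fun n => n (+) p).
Proof. by move=> m n /(congr1 (fun x => x (+) p)); rewrite !nimK. Qed.

Lemma nim_div2 m n : Nat.div2 (m (+) n) = Nat.div2 m (+) Nat.div2 n.
Proof.
apply: Nat.bits_inj => i.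
by rewrite Nat.lxor_spec !Nat.testbit_div2 Nat.lxor_spec.
Qed.

Lemma nim_odd m n : Nat.odd (m (+) n) = addb (Nat.odd m) (Nat.odd n).
Proof.
rewrite -!Nat.bit0_odd Nat.lxor_spec.
by case: (Nat.testbit m 0); case: (Nat.testbit n 0).
Qed.

Lemma ltn_div2 m n : (m < n) =
  (Nat.div2 m < Nat.div2 n) ||
  [&& Nat.div2 m == Nat.div2 n, ~~ Nat.odd m & Nat.odd n].
Proof.
have := Nat.div2_odd m; have := Nat.div2_odd n.
by case: (Nat.odd m); case: (Nat.odd n) => /=; lia.
Qed.

(** This is what makes Grundy values of a sum combine by nim addition: a value
    below x (+) y is reached by lowering one of the two summands.  The leading
    bit at which w and x (+) y differ is set in exactly one of x and y, and
    clearing it there pays for any change in the lower bits.  The induction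
    strips the lowest bit. *)
Lemma ltn_nim w x y : w < x (+) y -> (w (+) y < x) \/ (w (+) x < y).
Proof.
have [k] := ubnP (w + x + y); elim: k w x y => // k IHk w x y le_k lt_w.
have [z|nz] := boolP ((w == 0) && (x == 0) && (y == 0)).
  by move: z lt_w => /andP[/andP[/eqP-> /eqP->] /eqP->].
move: lt_w; rewrite !(ltn_div2 (_ (+) _)) !(ltn_div2 w) !nim_div2 !nim_odd.
case/orP => [/IHk[]|].
- have := Nat.div2_odd w; have := Nat.div2_odd x; have := Nat.div2_odd y.
  by case: (Nat.odd w); case: (Nat.odd x); case: (Nat.odd y) => /=; lia.
- by move=> ->; left.
- by move=> ->; right.
case/and3P => /eqP-> /negPf-> /=.
rewrite nimK (nimC (Nat.div2 x)) nimK !eqxx.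
by case: (Nat.odd x); case: (Nat.odd y) => //= _; rewrite !orbT; auto.
Qed.

(** * Grundy values of runs of full columns *)

Definition grundy_table : seq nat :=
  [:: 0; 0; 2; 2; 1; 4; 3; 3; 1; 4; 2; 6;
      5; 0; 2; 7; 1; 4; 3; 3; 1; 4; 7; 7;
      5; 0; 2; 8; 4; 4; 6; 3; 1; 8; 7; 7;
      5; 0; 2; 2; 1; 4; 6; 3; 1; 8; 2; 7;
      5; 0; 2; 8; 1; 4; 6; 3; 1; 4; 2; 7;
      5; 0; 2; 8; 1; 4; 6; 3; 1; 8; 7; 7;
      5; 0; 2; 8; 1; 4; 6; 3; 1; 8; 2; 7].

(** The last row of the table, which starts at index 72, is the period; the
    entry 70 differs from the entry 82. *)
Definition grundy (n : nat) : nat :=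
  nth 0 grundy_table (if n < 72 then n else 72 + n %% 12).

(** The values of the positions reached by one move from n full columns.  The
    1 is the value of the lone cell left in the column that is broken. *)
Definition run_option (n w : nat) : Prop :=
  exists a b, (a + 1 + b = n /\ w = grundy a (+) 1 (+) grundy b)
           \/ (a + 2 + b = n /\ w = grundy a (+) grundy b).

Lemma grundy_period n : 72 <= n -> grundy (n + 12) = grundy n.
Proof.
move=> le72n; rewrite /grundy modnDr.
by rewrite !ifN // -leqNgt // (leq_trans le72n (leq_addr _ _)).
Qed.

Lemma grundy_eq0 n : 0 < n -> (grundy n == 0) = (n %% 12 == 1).
Proof.
move=> n_gt0; rewrite /grundy; case: ltnP => [lt_n|_].
  have: all (fun n => (nth 0 grundy_table n == 0) == (n %% 12 == 1)) (iota 1 71).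
    by vm_compute.
  by move/allP/(_ n); rewrite mem_iota n_gt0 => /(_ lt_n)/eqP.
have: all (fun r => (nth 0 grundy_table (72 + r) == 0) == (r == 1)) (iota 0 12).
  by vm_compute.
by move/allP/(_ (n %% 12)); rewrite mem_iota ltn_mod => /(_ isT)/eqP.
Qed.

(** The bound 157 comes from the passage from n + 12 down to n: if
    a + 2 + b = n + 12 >= 169, then a or b is at least 84, so that it can lose
    12 and still lie in the periodic range.  Going up only needs a or b to be
    at least 72. *)
Lemma run_option_period n w :
  157 <= n -> run_option (n + 12) w <-> run_option n w.
Proof.
move=> le_n; split=> -[a [b H]].
  have [lea|lta] := leqP 84 a.
    have Ea : grundy (a - 12) = grundy a.
      by rewrite -grundy_period ?subnK //; lia.
    by exists (a - 12), b; rewrite Ea; lia.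
  have Eb : grundy (b - 12) = grundy b.
    by rewrite -grundy_period ?subnK //; lia.
  by exists a, (b - 12); rewrite Eb; lia.
have [lea|lta] := leqP 72 a.
  by exists (a + 12), b; rewrite grundy_period //; lia.
by exists a, (b + 12); rewrite grundy_period; lia.
Qed.

Definition run_options (n : nat) : seq nat :=
  [seq grundy a (+) 1 (+) grundy (n - 1 - a) | a <- iota 0 n] ++
  [seq grundy a (+) grundy (n - 2 - a) | a <- iota 0 (n - 1)].

Lemma run_optionP n w : reflect (run_option n w) (w \in run_options n).
Proof.
apply: (iffP idP).
  rewrite mem_cat => /orP[] /mapP[a]; rewrite mem_iota => lt_a ->.
    by exists a, (n - 1 - a); left; split=> //; lia.
  by exists a, (n - 2 - a); right; split=> //; lia.
rewrite mem_cat => -[a [b [] [<- ->]]]; apply/orP; [left|right];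
  apply/mapP; exists a; rewrite ?mem_iota; try lia.
  by congr (_ (+) grundy _); lia.
by congr (_ (+) grundy _); lia.
Qed.

(** The first 169 values cover the range where [run_option_period] does not
    yet relate n to n - 12. *)
Definition mex_check (n : nat) : bool :=
  (grundy n \notin run_options n) &&
  all (fun w => w \in run_options n) (iota 0 (grundy n)).

Lemma mex_check_small n : n < 169 -> mex_check n.
Proof.
have /allP base : all mex_check (iota 0 169) by vm_compute.
by move=> lt_n; apply: base; rewrite mem_iota.
Qed.

Lemma grundy_mex n :
  ~ run_option n (grundy n) /\ (forall w, w < grundy n -> run_option n w).
Proof.
elim/ltn_ind: n => n IHn; have [le_n|/mex_check_small] := leqP 169 n.
  have [IHno IHyes] := IHn (n - 12) ltac:(lia).
  have -> : n = n - 12 + 12 by lia.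
  rewrite grundy_period; last by lia.
  by split=> [|w lt_w]; rewrite run_option_period; try lia; auto.
case/andP => /run_optionP no /allP yes.
by split=> // w lt_w; apply/run_optionP/yes; rewrite mem_iota.
Qed.

(** * The game on sequences of column heights *)

(** The accumulator r is the length of the run of full columns just before s,
    so that s is evaluated as if r full columns preceded it.  A column that is
    not full ends the run and contributes its parity: 1 for a lone cell, 0 for
    an empty column.  Empty runs are harmless since the value of a run of
    length 0 is 0. *)
Fixpoint nim_value (r : nat) (s : seq nat) : nat :=
  if s is c :: s' then
    if c == 2 then nim_value r.+1 s'
    else grundy r (+) odd c (+) nim_value 0 s'
  else grundy r.

Inductive column_move : seq nat -> seq nat -> Prop :=
| take_single p q : column_move (p ++ 1 :: q) (p ++ 0 :: q)
| break_column p q : column_move (p ++ 2 :: q) (p ++ 1 :: q)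
| take_square p q : column_move (p ++ 2 :: 2 :: q) (p ++ 0 :: 0 :: q).

Lemma column_move_cat p s t q :
  column_move s t -> column_move (p ++ s ++ q) (p ++ t ++ q).
Proof.
case=> p' q'; rewrite -!catA /= !(catA p); by constructor.
Qed.

(** A prefix acts on what follows only through the length a of its trailing
    run, and a suffix on what precedes it only through the length b of its
    leading run.  Together the next two lemmas localize a move to the run that
    contains it, without a decomposition of the sequence into maximal runs. *)
Lemma nim_value_catl r p :
  exists x a, forall q, nim_value r (p ++ q) = x (+) nim_value a q.
Proof.
elim: p r => [|c p IHp] r /=; first by exists 0, r => q; rewrite nim0n.
case: (c == 2); first exact: IHp.
have [x [a E]] := IHp 0.
by exists (grundy r (+) odd c (+) x), a => q; rewrite E !nimA.
Qed.

Lemma nim_value_run q :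
  exists y b, forall a, nim_value a q = grundy (a + b) (+) y.
Proof.
elim: q => [|c q [y [b E]]] /=; first by exists 0, 0 => a; rewrite addn0 nimn0.
case: (c == 2); first by exists y, b.+1 => a; rewrite E addSnnS.
by exists (odd c (+) nim_value 0 q), 0 => a; rewrite addn0 !nimA.
Qed.

Lemma nim_value_split r p c q : c != 2 ->
  nim_value r (p ++ c :: q) = nim_value r p (+) odd c (+) nim_value 0 q.
Proof.
move=> /negPf c2; elim: p r => [|d p IHp] r /=; first by rewrite c2.
by case: (d == 2); rewrite IHp // !nimA.
Qed.

Lemma nim_value_nseq r k q : nim_value r (nseq k 2 ++ q) = nim_value (r + k) q.
Proof. by elim: k r => [|k IHk] r /=; rewrite ?addn0 // IHk addSnnS. Qed.

(** Once the common summands x and y are cancelled, equality of the two values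
    would make the value of a run equal to one of its own options, or that of
    a lone cell equal to that of an empty column. *)
Lemma column_move_neq s t :
  column_move s t -> nim_value 0 s <> nim_value 0 t.
Proof.
case=> p q; have [x [a Ex]] := nim_value_catl 0 p; rewrite !Ex !(nimC x);
  move/nimI => /=.
- by move/nimI; rewrite !(nimC (grundy a)) => /nimI.
- have [y [b Ey]] := nim_value_run q; rewrite !Ey nimA => /nimI E.
  have [no _] := grundy_mex (a.+1 + b); apply: no; exists a, b; left.
  by split=> //; lia.
have [y [b Ey]] := nim_value_run q; rewrite !Ey !nimn0 nim0n nimA => /nimI E.
have [no _] := grundy_mex (a.+2 + b); apply: no; exists a, b; right.
by split=> //; lia.
Qed.

Lemma run_reach r w : w < grundy r ->
  exists2 t, column_move (nseq r 2) t & nim_value 0 t = w.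
Proof.
have [_ yes] := grundy_mex r; case/yes => a [b [] [<- ->]].
  exists (nseq a 2 ++ 1 :: nseq b 2); first by rewrite -addnA nseqD; constructor.
  rewrite nim_value_nseq /= -[nseq b 2]cats0 nim_value_nseq //.
exists (nseq a 2 ++ 0 :: 0 :: nseq b 2).
  by rewrite -addnA nseqD; constructor.
by rewrite nim_value_nseq /= -[nseq b 2]cats0 nim_value_nseq !nimn0 nim0n.
Qed.

(** The r full columns in front are the run collected so far by [nim_value], so
    that the induction on s reaches each component with its full length.  The
    target w is arbitrary because the induction moves it by the value of the
    components left behind. *)
Lemma nim_value_reach r s w : all (geq 2) s -> w < nim_value r s ->
  exists2 t, column_move (nseq r 2 ++ s) t & nim_value 0 t = w.
Proof.
elim: s r w => [|c s IHs] r w /=; first by rewrite cats0 => _; exact: run_reach.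
case/andP=> c_le2 s_le2; case: eqP => [-> lt_w|/eqP c2].
  by rewrite -[2 :: s]/(nseq 1 2 ++ s) catA -nseqD addn1; exact: IHs.
have split_first t : nim_value 0 (t ++ c :: s) =
    nim_value 0 t (+) (odd c (+) nim_value 0 s).
  by rewrite nim_value_split // nimA.
rewrite -nimA => /ltn_nim[] lt_w.
  (* lower the run that the column c closes *)
  have [t mv Et] := run_reach lt_w.
  exists (t ++ c :: s); first exact: (column_move_cat [::] (c :: s) mv).
  by rewrite split_first Et nimK.
have Er : nim_value 0 (nseq r 2) = grundy r.
  by rewrite -[nseq r 2]cats0 nim_value_nseq.
case/ltn_nim: lt_w => lt_w.
  (* a component of value below 1 can only be lowered if c is a lone cell *)
  have c1 : c = 1 by case: c c2 c_le2 lt_w {split_first} => [|[|[|]]].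
  rewrite {}c1 in lt_w *.
  exists (nseq r 2 ++ 0 :: s); first by constructor.
  move: lt_w; rewrite nim_value_split // Er /= => /[!ltnS].
  rewrite leqn0 => /eqP /(congr1 (fun x => x (+) nim_value 0 s)).
  rewrite nimK nim0n nimn0 => <-.
  by rewrite nimC nimK.
(* lower a component to the right of c *)
have [t mv Et] := IHs 0 _ s_le2 lt_w.
exists (nseq r 2 ++ c :: t).
  by have := column_move_cat (rcons (nseq r 2) c) [::] mv; rewrite !cats0 !cat_rcons.
rewrite nim_value_split // Er Et -nimA (nimC (grundy r)).
by rewrite (nimC (odd c)) nimK nimK.
Qed.

(** * From positions to column heights *)

Definition column (A : position) (j : nat) : nat :=
  ((0, j%:Z)%R \in A) + ((1, j%:Z)%R \in A).

Definition columns (n : nat) (A : position) : seq nat := mkseq (column A) n.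

Definition strip (n : nat) : position := rectangle (0%R, 0%R) 2 n.

Lemma in_rectangle c m n (x : cell) : x \in rectangle c m n =
  [&& (c.1 <= x.1)%R, (x.1 < c.1 + m%:Z)%R,
      (c.2 <= x.2)%R & (x.2 < c.2 + n%:Z)%R].
Proof.
apply/imfset2P/idP => [[i + [j + ->]]|].
  by rewrite /= !mem_iota; lia.
case: x => x1 x2 /= H; exists `|x1 - c.1|%N; first by rewrite /= mem_iota; lia.
by exists `|x2 - c.2|%N; [rewrite /= mem_iota; lia | congr (_, _); lia].
Qed.

Lemma in_strip n (A : position) (x : cell) : A `<=` strip n -> x \in A ->
  exists2 j : nat, j < n & x = (0, j%:Z)%R \/ x = (1, j%:Z)%R.
Proof.
move=> /fsubsetP sA /sA; rewrite in_rectangle; case: x => x1 x2 /= H.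
exists `|x2|%N; first by lia.
have [-> | ->] : x1 = 0%R \/ x1 = 1%R by lia.
  by left; congr (_, _); lia.
by right; congr (_, _); lia.
Qed.


(** A change of position confined to a window of columns only rewrites the
    corresponding factor of the sequence of heights. *)
Lemma columns_replace n A B p s q :
  columns n A = p ++ s ++ q ->
  (forall j, ~~ (size p <= j < size p + size s) -> column B j = column A j) ->
  columns n B = p ++ map (column B) (iota (size p) (size s)) ++ q.
Proof.
move=> EA eqBA; have En : n = size p + (size s + size q).
  by rewrite -!size_cat -EA size_mkseq.
rewrite /columns /mkseq En !iotaD !map_cat !add0n in EA *.
move/eqP: EA; rewrite !eqseq_cat ?size_map ?size_iota //.
case/and3P => /eqP Ep _ /eqP Eq.
congr (_ ++ (_ ++ _)); [rewrite -[RHS]Ep | rewrite -[RHS]Eq];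
  by apply/eq_in_map => j; rewrite mem_iota => ?; apply: eqBA; lia.
Qed.

Lemma columns_split n A i k : i + k <= n -> exists p q,
  size p = i /\ columns n A = p ++ map (column A) (iota i k) ++ q.
Proof.
move=> le_n; exists (map (column A) (iota 0 i)).
exists (map (column A) (iota (i + k) (n - (i + k)))).
by rewrite size_map size_iota -!map_cat -iotaD -{2}[i]add0n -iotaD addnA subnKC.
Qed.

Lemma columns_nth n A p c q :
  columns n A = p ++ c :: q -> column A (size p) = c.
Proof.
move=> E; have lt_p : size p < n.
  by rewrite -(size_mkseq (column A) n) -/(columns n A) E size_cat /=; lia.
by rewrite -(nth_mkseq 0 (column A) lt_p) -/(columns n A) E nth_cat ltnn subnn.
Qed.

Lemma column_remove c k (A : position) j :
  column (A `\` rectangle c k k) j =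
  if (c.2 <= j%:Z < c.2 + k%:Z)%R then
    (((0, j%:Z)%R \in A) && ~~ (c.1 <= 0 < c.1 + k%:Z)%R) +
    (((1, j%:Z)%R \in A) && ~~ (c.1 <= 1 < c.1 + k%:Z)%R)
  else column A j.
Proof.
rewrite /column !inE !in_rectangle /=.
by case: ifP => Hj; congr (nat_of_bool _ + nat_of_bool _);
  rewrite andbC; case: (_ \in A) => //=; lia.
Qed.

Lemma columns_remove n A (x : int) p k s q :
  columns n A = p ++ s ++ q -> size s = k ->
  columns n (A `\` rectangle (x, (size p)%:Z)%R k k) =
  p ++ map (fun j => (((0, j%:Z)%R \in A) && ~~ (x <= 0 < x + k%:Z)%R) +
                     (((1, j%:Z)%R \in A) && ~~ (x <= 1 < x + k%:Z)%R))
         (iota (size p) k) ++ q.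
Proof.
move=> EA sz_s; rewrite (columns_replace EA) => [|j j_out].
  rewrite sz_s; congr (_ ++ (_ ++ _)); apply/eq_in_map => j.
  by rewrite mem_iota column_remove /= => j_in; rewrite ifT //; lia.
by rewrite column_remove /= ifF //; lia.
Qed.

(** The strip has height 2 (its rows are 0 and 1), so the upper right corner
    of a square in it forces the side to be 1, or 2 with lowest row 0. *)
Lemma move_columns n A B : A `<=` strip n -> move A B ->
  column_move (columns n A) (columns n B).
Proof.
move=> sA [k [[x y] [k_gt0 /fsubsetP sRA ->]]].
have cell_in i j : i < k -> j < k -> (x + i%:Z, y + j%:Z)%R \in A.
  by move=> lt_i lt_j; apply: sRA; rewrite in_rectangle /=; lia.
have [j lt_j Exy] := in_strip sA (cell_in 0 0 k_gt0 k_gt0).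
have Ey : y = j%:Z%R by case: Exy => -[]; lia.
have Ex : x = 0%R \/ x = 1%R by case: Exy => -[]; [left|right]; lia.
rewrite {}Ey {Exy} in cell_in sRA *.
have [k2|k1] := leqP 2 k.
  have [j' lt_j' corner] := in_strip sA (cell_in k.-1 k.-1 ltac:(lia) ltac:(lia)).
  have [Ek x0] : k = 2 /\ x = 0%R by case: corner => -[]; lia.
  rewrite {}Ek {}x0 {k2 k_gt0 sRA Ex} in cell_in corner *.
  have [p [q [sz_p EA]]] : exists p q, size p = j /\
      columns n A = p ++ map (column A) (iota j 2) ++ q.
    by apply: columns_split; case: corner => -[]; lia.
  rewrite -sz_p (columns_remove _ EA) ?size_map ?size_iota // EA /= sz_p.
  rewrite /column -[j.+1]addn1.
  have := cell_in 0 0 isT isT; have := cell_in 1 0 isT isT.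
  have := cell_in 0 1 isT isT; have := cell_in 1 1 isT isT.
  rewrite !add0r !addr0 => -> -> -> -> /=.
  by constructor.
have Ek : k = 1 by lia.
rewrite {}Ek {k1 k_gt0 sRA} in cell_in *.
have [p [q [sz_p EA]]] := @columns_split n A j 1 ltac:(lia).
rewrite -sz_p (columns_remove _ EA) ?size_map ?size_iota // EA /= sz_p /column.
have := cell_in 0 0 isT isT; rewrite !addr0.
by case: Ex => -> -> /=; case: (_ \in A) => /=; constructor.
Qed.

(** The converse: every move on heights is played on the board.  In a column
    of height 1 the cell that is taken is whichever of the two is there. *)
Lemma columns_move n A t : column_move (columns n A) t ->
  exists2 B, move A B & columns n B = t.
Proof.
have single p q (x : int) : (x = 0%R) \/ (x = 1%R) ->
    (x, (size p)%:Z)%R \in A -> columns n A = p ++ column A (size p) :: q ->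
    exists2 B, move A B & columns n B = p ++ (column A (size p)).-1 :: q.
  move=> x01 xA EA; exists (A `\` rectangle (x, (size p)%:Z)%R 1 1).
    exists 1, (x, (size p)%:Z)%R; split=> //; apply/fsubsetP => -[a b].
    rewrite in_rectangle /= => H.
    by have [-> ->] : a = x /\ b = (size p)%:Z%R by lia.
  rewrite (@columns_remove n A x p 1 [:: _] q EA) // /= /column.
  by case: x01 xA => -> -> /=; case: (_ \in A).
move E: (columns n A) => s mv; case: mv E => p q E.
- have Ec := columns_nth E.
  have [] := boolP ((0, (size p)%:Z)%R \in A) => [in0|nin0].
    by have := single p q 0%R (or_introl erefl) in0; rewrite Ec; apply.
  have in1 : (1, (size p)%:Z)%R \in A.
    by move: Ec; rewrite /column (negPf nin0); case: (_ \in A).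
  by have := single p q 1%R (or_intror erefl) in1; rewrite Ec; apply.
- have Ec := columns_nth E.
  have in0 : (0, (size p)%:Z)%R \in A.
    by move: Ec; rewrite /column; case: (_ \in A); case: (_ \in A).
  by have := single p q 0%R (or_introl erefl) in0; rewrite Ec; apply.
have Ec := columns_nth E.
have Ec' : column A (size p).+1 = 2.
  by rewrite -(size_rcons p 2); apply: columns_nth; rewrite cat_rcons; exact: E.
have full j : column A j = 2 -> (0, j%:Z)%R \in A /\ (1, j%:Z)%R \in A.
  by rewrite /column; case: (_ \in A); case: (_ \in A).
exists (A `\` rectangle (0, (size p)%:Z)%R 2 2).
  exists 2, (0, (size p)%:Z)%R; split=> //; apply/fsubsetP => -[a b].
  rewrite in_rectangle /= => H.
  have [Ea Eb] : (a = 0 \/ a = 1)%R /\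
      (b = (size p)%:Z \/ b = (size p).+1%:Z)%R by lia.
  have [c00 c10] := full _ Ec; have [c01 c11] := full _ Ec'.
  by case: Ea => ->; case: Eb => ->.
rewrite (@columns_remove n A 0%R p 2 [:: 2; 2] q E) //=.
by rewrite !andbF.
Qed.

(** * Classification of the positions in the strip *)

Lemma move_to_nim_value0 n A : A `<=` strip n ->
  nim_value 0 (columns n A) <> 0 ->
  exists2 B, move A B & nim_value 0 (columns n B) = 0.
Proof.
move=> sA /eqP; rewrite -lt0n => v_gt0.
have le2 : all (geq 2) (columns n A).
  apply/allP => _ /mapP[j _ ->] /=; rewrite /column.
  by case: (_ \in A); case: (_ \in A).
have [t mv Et] := nim_value_reach le2 v_gt0.
by have [B mvB EB] := columns_move mv; exists B => //; rewrite EB.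
Qed.

Lemma move_card A B : move A B -> #|` B| < #|` A|.
Proof.
case=> k [c [k_gt0 sRA ->]]; apply: fproper_ltn_card.
rewrite fproperEneq fsubsetDl andbT; apply/eqP => E.
have cR : c \in rectangle c k k by rewrite in_rectangle; lia.
by have := fsubsetP sRA c cR; rewrite -E inE cR.
Qed.

(** Both equivalences are proved together because each class is defined from
    the other.  A position of nim-sum 0 only moves to nonzero nim-sums, and one
    of nonzero nim-sum has a move to nim-sum 0. *)
Lemma P_position_nim_value n A : A `<=` strip n ->
  (P_position A <-> nim_value 0 (columns n A) = 0) /\
  (N_position A <-> nim_value 0 (columns n A) <> 0).
Proof.
have [m] := ubnP #|` A|; elim: m A => // m IHm A lt_m sA.
have IH B (mv : move A B) := IHm B (leq_trans (move_card mv) lt_m).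
have sub B : move A B -> B `<=` strip n.
  by case=> k [c [_ _ ->]]; apply: fsubset_trans sA; exact: fsubsetDl.
have neq B (mv : move A B) := column_move_neq (move_columns sA mv).
split; split.
- case=> allN; case: (eqVneq (nim_value 0 (columns n A)) 0) => // /eqP v_neq0.
  have [B mv vB] := move_to_nim_value0 sA v_neq0.
  by have [_ [/(_ (allN B mv))]] := IH B mv (sub B mv); rewrite vB.
- move=> v0; constructor=> B mv; have [_ [_]] := IH B mv (sub B mv); apply.
  by move=> vB; apply: (neq B mv); rewrite v0 vB.
- case=> B mv PB; have [[/(_ PB) vB _] _] := IH B mv (sub B mv).
  by move=> v0; apply: (neq B mv); rewrite v0 vB.
move=> v_neq0; have [B mv vB] := move_to_nim_value0 sA v_neq0.
have [[_ PB] _] := IH B mv (sub B mv); exact: N_intro mv (PB vB).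
Qed.

Theorem corollary8 (n : nat) (hn : 1 <= n) :
  P_position (rectangle (0%R, 0%R) 2 n) <-> exists a : nat, n = 12 * a + 1.
Proof.
have [-> _] := P_position_nim_value (fsubset_refl (strip n)).
have -> : columns n (strip n) = nseq n 2.
  apply: (@eq_from_nth _ 0) => [|i]; rewrite size_mkseq ?size_nseq // => lt_i.
  by rewrite nth_mkseq // nth_nseq lt_i /column !in_rectangle /=; lia.
rewrite -[nseq n 2]cats0 nim_value_nseq /= add0n.
split=> [/eqP|[a ->]]; last first.
  by apply/eqP; rewrite grundy_eq0 ?addn1 // -addn1 mulnC modnMDl.
by rewrite grundy_eq0 // => /eqP E; exists (n %/ 12); lia.
Qed.
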